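(* An integral domain $D$ is a $\ast$-SH domain of type $2$ if and only if $D$ is a $\ast$-Krull domain.
   Context: $\ast$ is a star operation on $D$ of finite character. A $\ast$-ideal is a nonzero fractional ideal $I$ with $I^\ast=I$; it is of finite type if $I=J^\ast$ for some nonzero finitely generated $J$. A maximal $\ast$-ideal is an integral $\ast$-ideal maximal among proper integral $\ast$-ideals. A $\ast$-homog ideal is an integral $\ast$-ideal $I$ of finite type with $I\subsetneq D$ such that $(J+L)^{\ast}\neq D$ for every pair $J,L$ of proper integral $\ast$-ideals of finite type containing $I$; such $I$ lies in a unique maximal $\ast$-ideal $M(I)$. $D$ is a $\ast$-SH domain if every $xD$, $x$ a nonzero nonunit, is a $\ast$-product $(I_1\cdots I_n)^\ast$ of finitely many $\ast$-homog ideals. A $\ast$-homog ideal $I$ is of type $2$ if $I=((M(I))^n)^\ast$ for some positive integer $n$; $D$ is a $\ast$-SH domain of type $2$ if for every nonzero nonunit $x$, $xD$ is a $\ast$-product of finitely many $\ast$-homog ideals of type $2$. $D$ is a $\ast$-weakly Krull domain if it is a $\ast$-SH domain all of whose maximal $\ast$-ideals have height $1$; $D$ is a $\ast$-Krull domain if it is a $\ast$-weakly Krull domain such that $D_P$ is a rank-one discrete valuation domain for every maximal $\ast$-ideal $P$. *)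

(* Defs.v *)
(* Ideals of D are modelled as subsets (K -> Prop) of the
   quotient field K of D; D itself is a subring of K with fraction field K. *)
From HB Require Import structures.
From mathcomp Require Import all_boot all_order all_algebra.
From Stdlib Require List.
Set Implicit Arguments. Unset Strict Implicit. Unset Printing Implicit Defensive.
Import Order.TTheory GRing.Theory Num.Theory.
Local Open Scope ring_scope.

Section Defs.
Variable K : fieldType.

Definition kset := K -> Prop.
Definition subk (A B : kset) := forall x, A x -> B x.

Definition is_subring (D : kset) : Prop :=
  [/\ D 1, (forall x y, D x -> D y -> D (x - y)) & (forall x y, D x -> D y -> D (x * y))].

Definition frac_field (D : kset) : Prop :=
  forall x, exists a b, [/\ D a, D b, b != 0 & x = a / b].

Definition is_unit_in (D : kset) (x : K) : Prop := exists y, D y /\ x * y = 1.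

Definition is_submodule (D I : kset) : Prop :=
  [/\ I 0, (forall x y, I x -> I y -> I (x + y)) & (forall d x, D d -> I x -> I (d * x))].

Definition nonzero (I : kset) : Prop := exists x, I x /\ x != 0.

Definition is_frac_ideal (D I : kset) : Prop :=
  [/\ is_submodule D I, nonzero I & exists d, [/\ D d, d != 0 & forall x, I x -> D (d * x)]].

Definition integral (D I : kset) : Prop := subk I D.

Definition scale (x : K) (I : kset) : kset := fun y => exists z, I z /\ y = x * z.
Definition principal (D : kset) (x : K) : kset := scale x D.

Definition span (D : kset) (s : seq K) : kset := fun y =>
  exists c : seq K, [/\ size c = size s, (forall i, D c`_i) &
                        y = \sum_(i < size s) c`_i * s`_i].

Definition iadd (I J : kset) : kset := fun y => exists a b, [/\ I a, J b & y = a + b].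

Definition imul (I J : kset) : kset := fun y =>
  exists a b : seq K, [/\ size a = size b,
    (forall i, (i < size a)%N -> I a`_i /\ J b`_i) &
    y = \sum_(i < size a) a`_i * b`_i].

Definition iprod (D : kset) (l : seq kset) : kset := foldr imul D l.
Definition ipow (D I : kset) (n : nat) : kset := iprod D (nseq n I).

Definition is_star_op (D : kset) (star : kset -> kset) : Prop :=
  (forall I, is_frac_ideal D I -> is_frac_ideal D (star I)) /\
  [/\ (forall x, x != 0 -> star (principal D x) = principal D x),
      (forall x I, x != 0 -> is_frac_ideal D I -> star (scale x I) = scale x (star I)),
      (forall I, is_frac_ideal D I -> subk I (star I)),
      (forall I J, is_frac_ideal D I -> is_frac_ideal D J -> subk I J -> subk (star I) (star J))
    & (forall I, is_frac_ideal D I -> star (star I) = star I)].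

Definition finite_character (D : kset) (star : kset -> kset) : Prop :=
  forall I, is_frac_ideal D I -> forall x,
    star I x <-> exists s, [/\ nonzero (span D s), subk (span D s) I & star (span D s) x].

Definition star_ideal D star (I : kset) : Prop := is_frac_ideal D I /\ star I = I.

Definition finite_type D star (I : kset) : Prop :=
  exists s, nonzero (span D s) /\ I = star (span D s).

Definition max_star_ideal D star (M : kset) : Prop :=
  [/\ star_ideal D star M, integral D M, M <> D &
      forall N, star_ideal D star N -> integral D N -> N <> D -> subk M N -> N = M].

Definition star_homog D star (I : kset) : Prop :=
  [/\ star_ideal D star I, integral D I, finite_type D star I, I <> D &
      forall J L,
        star_ideal D star J -> integral D J -> finite_type D star J -> J <> D -> subk I J ->
        star_ideal D star L -> integral D L -> finite_type D star L -> L <> D -> subk I L ->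
        star (iadd J L) <> D].

(* type 2: I = (M(I)^n)^* with M(I) the (unique) maximal star-ideal containing I *)
Definition star_homog_type2 D star (I : kset) : Prop :=
  star_homog D star I /\
  exists M n, [/\ max_star_ideal D star M, subk I M, (0 < n)%N & I = star (ipow D M n)].

Definition star_SH D star : Prop :=
  forall x, D x -> x != 0 -> ~ is_unit_in D x ->
    exists l : seq kset, (forall I, List.In I l -> star_homog D star I) /\
                         principal D x = star (iprod D l).

Definition star_SH_type2 D star : Prop :=
  forall x, D x -> x != 0 -> ~ is_unit_in D x ->
    exists l : seq kset, (forall I, List.In I l -> star_homog_type2 D star I) /\
                         principal D x = star (iprod D l).

Definition zero_ideal : kset := fun y => y = 0.

Definition prime_ideal (D P : kset) : Prop :=
  [/\ is_submodule D P, integral D P, P <> D &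
      forall a b, D a -> D b -> P (a * b) -> P a \/ P b].

Definition height_one (D P : kset) : Prop :=
  [/\ prime_ideal D P, P <> zero_ideal &
      forall Q, prime_ideal D Q -> subk Q P -> Q = zero_ideal \/ Q = P].

Definition localization (D P : kset) : kset := fun y =>
  exists a s, [/\ D a, D s, ~ P s & y = a / s].

Definition rank_one_dvr (V : kset) : Prop :=
  exists v : K -> int,
    [/\ (forall x y, x != 0 -> y != 0 -> v (x * y) = v x + v y),
        (forall x y, x != 0 -> y != 0 -> x + y != 0 -> Num.min (v x) (v y) <= v (x + y)),
        (exists t, t != 0 /\ v t = 1)
      & forall x, V x <-> (x = 0 \/ (x != 0 /\ 0 <= v x))].

Definition star_weakly_Krull D star : Prop :=
  star_SH D star /\ forall P, max_star_ideal D star P -> height_one D P.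

Definition star_Krull D star : Prop :=
  star_weakly_Krull D star /\
  forall P, max_star_ideal D star P -> rank_one_dvr (localization D P).

End Defs.

(* Main.v *)
(* A maximal star-ideal P is prime.  If star-ideals P^n are among the factors of xD, then P divides a
   principal ideal, so it is star-invertible; hence P D_P = p D_P for some p, and the factorization of
   an arbitrary yD shows that y is a power of p times a unit of D_P.  So D_P is a discrete valuation
   ring, and P has height one.

   Conversely let I be star-homogeneous.  M = {x in D | (I, x)^* <> D} is a maximal star-ideal, the only
   one containing I.  In a star-SH domain a star-ideal is determined by its localizations at the maximal
   star-ideals, so when D_M is a discrete valuation ring, both I and (M^n)^* equal the symbolic power
   p^n D_M :&: D, where n is the least valuation of an element of I. *)
From HB Require Import structures.
From mathcomp Require Import all_boot all_order all_algebra.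
From mathcomp Require Import ring.
Require Import Defs.
From Stdlib Require Import Classical ClassicalEpsilon.
From Stdlib Require Import FunctionalExtensionality PropExtensionality.
Set Implicit Arguments. Unset Strict Implicit. Unset Printing Implicit Defensive.
Import Order.TTheory GRing.Theory Num.Theory.
Local Open Scope ring_scope.

Lemma kset_ext (K : fieldType) (A B : kset K) : subk A B -> subk B A -> A = B.
Proof.
move=> AB BA; apply: functional_extensionality => x.
by apply: propositional_extensionality; split; [apply: AB | apply: BA].
Qed.

(** * Submodules of the fraction field *)

Section Subring.
Variables (K : fieldType) (D : kset K).
Hypothesis HD : is_subring D.
Implicit Types (A B I J L P Q : kset K) (x y z : K) (s t : seq K).

Lemma ring1 : D 1. Proof. by case: HD. Qed.

Lemma ringM x y : D x -> D y -> D (x * y).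
Proof. by case: HD => _ _; apply. Qed.

Lemma ring0 : D 0.
Proof. by case: HD => d1 dB _; rewrite -(subrr 1); apply: dB. Qed.

Lemma ringD x y : D x -> D y -> D (x + y).
Proof.
case: HD => _ dB _ dx dy.
by rewrite -[y]opprK -[- y]add0r; apply: (dB _ _ dx); apply: dB => //; apply: ring0.
Qed.

Lemma ringX x n : D x -> D (x ^+ n).
Proof.
move=> dx; elim: n => [|n IHn]; first by rewrite expr0; apply: ring1.
by rewrite exprS; apply: ringM.
Qed.

Lemma ring_submodule : is_submodule D D.
Proof. by split; [apply: ring0 | apply: ringD | apply: ringM]. Qed.

Lemma submodule_eq_ring I : is_submodule D I -> integral D I -> I 1 -> I = D.
Proof.
move=> [_ _ IM] ID I1; apply: kset_ext => // x dx.
by rewrite -[x]mulr1; apply: IM.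
Qed.

Lemma submodule_sum I n (F : 'I_n -> K) :
  is_submodule D I -> (forall i, I (F i)) -> I (\sum_(i < n) F i).
Proof. by move=> [I0 IA _] IF; apply: (big_ind I). Qed.

Definition ideal_int I := [/\ is_submodule D I, nonzero I & integral D I].

Lemma ideal_int_frac I : ideal_int I -> is_frac_ideal D I.
Proof.
move=> [Is In II]; split=> //; exists 1; split; rewrite ?oner_eq0 //.
  exact: ring1.
by move=> x /II; rewrite mul1r.
Qed.

Lemma ring_ideal_int : ideal_int D.
Proof.
split=> //; first exact: ring_submodule.
by exists 1; rewrite oner_neq0; split=> //; apply: ring1.
Qed.

Lemma ring_frac : is_frac_ideal D D.
Proof. exact/ideal_int_frac/ring_ideal_int. Qed.

Lemma ring_principal : principal D 1 = D.
Proof.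
apply: kset_ext => x; first by case=> y [dy ->]; rewrite mul1r.
by move=> dx; exists x; rewrite mul1r.
Qed.

Lemma scale_submodule x I : is_submodule D I -> is_submodule D (scale x I).
Proof.
move=> [I0 IA IM]; split.
- by exists 0; rewrite mulr0.
- move=> _ _ [a [Ia ->]] [b [Ib ->]]; exists (a + b).
  by split; [apply: IA | rewrite mulrDr].
- move=> d _ Dd [a [Ia ->]]; exists (d * a).
  by split; [apply: IM | ring].
Qed.

Lemma iadd_submodule I J :
  is_submodule D I -> is_submodule D J -> is_submodule D (iadd I J).
Proof.
move=> [I0 IA IM] [J0 JA JM]; split.
- by exists 0, 0; rewrite addr0.
- move=> _ _ [a [b [Ia Jb ->]]] [c [d [Ic Jd ->]]]; exists (a + c), (b + d).
  by split; [apply: IA | apply: JA | ring].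
- move=> e _ De [a [b [Ia Jb ->]]]; exists (e * a), (e * b).
  by split; [apply: IM | apply: JM | rewrite mulrDr].
Qed.

Lemma iaddl I J : is_submodule D J -> subk I (iadd I J).
Proof. by move=> [J0 _ _] x Ix; exists x, 0; rewrite addr0. Qed.

Lemma iaddr I J : is_submodule D I -> subk J (iadd I J).
Proof. by move=> [I0 _ _] x Jx; exists 0, x; rewrite add0r. Qed.

Lemma iadd_sub I J L : is_submodule D L -> subk I L -> subk J L -> subk (iadd I J) L.
Proof.
by move=> [_ LA _] IL JL _ [a [b [Ia Jb ->]]]; apply: LA; [apply: IL | apply: JL].
Qed.

Lemma span_submodule s : is_submodule D (span D s).
Proof.
split.
- exists (nseq (size s) 0); rewrite size_nseq; split=> // [i|].
    by rewrite nth_nseq if_same; apply: ring0.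
  by rewrite big1 // => i _; rewrite nth_nseq if_same mul0r.
- move=> _ _ [c [sc cD ->]] [d [sd dD ->]].
  exists (mkseq (fun i => c`_i + d`_i) (size s)); split.
  + by rewrite size_mkseq.
  + move=> i; case: (ltnP i (size s)) => hi.
      by rewrite nth_mkseq //; apply: ringD.
    by rewrite nth_default ?size_mkseq //; apply: ring0.
  + rewrite -big_split /=; apply: eq_bigr => i _.
    by rewrite nth_mkseq // mulrDl.
- move=> a _ aD [c [sc cD ->]].
  exists (map ( *%R a) c); split.
  + by rewrite size_map.
  + move=> i; case: (ltnP i (size c)) => hi.
      by rewrite (nth_map 0) //; apply: ringM.
    by rewrite nth_default ?size_map //; apply: ring0.
  + rewrite big_distrr /=; apply: eq_bigr => i _.
    by rewrite (nth_map 0) ?sc // mulrA.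
Qed.

Lemma span_mem s x : x \in s -> span D s x.
Proof.
move=> xs; have hi : (index x s < size s)%N by rewrite index_mem.
exists (mkseq (fun i => (i == index x s)%:R) (size s)); split.
- by rewrite size_mkseq.
- move=> i; case: (ltnP i (size s)) => hj.
    by rewrite nth_mkseq //; case: eqP => _; [apply: ring1 | apply: ring0].
  by rewrite nth_default ?size_mkseq //; apply: ring0.
- rewrite (bigD1 (Ordinal hi)) //= nth_mkseq // eqxx mul1r nth_index //.
  rewrite big1 ?addr0 // => i; rewrite -val_eqE /= nth_mkseq //.
  by move/negPf ->; rewrite mul0r.
Qed.

Lemma span_sub s I : is_submodule D I -> (forall x, x \in s -> I x) -> subk (span D s) I.
Proof.
move=> Isub sI _ [c [sc cD ->]]; apply: submodule_sum => // i.
by case: Isub => _ _ IM; apply: IM => //; apply: sI; apply: mem_nth.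
Qed.

(** A single list of pairs can be concatenated and rescaled without carrying along the equality of
    two lengths, so closure of products under sums becomes immediate. *)
Lemma imulP I J y :
  imul I J y <-> exists s : seq (K * K),
    (forall p, p \in s -> I p.1 /\ J p.2) /\ y = \sum_(p <- s) p.1 * p.2.
Proof.
split.
- move=> [a [b [sab IJ ->]]]; exists (zip a b); split.
    move=> p /(nthP (0, 0)) [i]; rewrite size_zip -sab minnn => hi <-.
    by rewrite nth_zip //; apply: IJ.
  rewrite (big_nth (0, 0)) size_zip -sab minnn big_mkord.
  by apply: eq_bigr => i _; rewrite nth_zip.
- move=> [s [sIJ ->]]; exists (unzip1 s), (unzip2 s); split.
  + by rewrite !size_map.
  + move=> i; rewrite size_map => hi.
    by rewrite !(nth_map (0, 0)) //; apply: sIJ; apply: mem_nth.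
  + rewrite (big_nth (0, 0)) size_map big_mkord.
    by apply: eq_bigr => i _; rewrite !(nth_map (0, 0)).
Qed.

Lemma imul_mem I J x y : I x -> J y -> imul I J (x * y).
Proof.
move=> Ix Jy; apply/imulP; exists [:: (x, y)].
by rewrite big_seq1; split=> // p; rewrite inE => /eqP ->.
Qed.

Lemma imul_sub I J L : is_submodule D L ->
  (forall x y, I x -> J y -> L (x * y)) -> subk (imul I J) L.
Proof.
move=> Lsub IJL _ [a [b [sab IJ ->]]]; apply: submodule_sum => // i.
by have [] := IJ i (ltn_ord i); apply: IJL.
Qed.

Lemma imul_submodule I J : is_submodule D I -> is_submodule D (imul I J).
Proof.
move=> [_ _ IM]; split.
- by apply/imulP; exists [::]; rewrite big_nil.
- move=> _ _ /imulP [s [sIJ ->]] /imulP [t [tIJ ->]].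
  apply/imulP; exists (s ++ t); rewrite big_cat; split=> // p.
  by rewrite mem_cat => /orP [/sIJ | /tIJ].
- move=> d _ dD /imulP [s [sIJ ->]].
  apply/imulP; exists [seq (d * p.1, p.2) | p <- s]; split.
    by move=> p /mapP [q /sIJ [Iq Jq] ->]; split=> //; apply: IM.
  by rewrite big_map big_distrr /=; apply: eq_bigr => p _; rewrite mulrA.
Qed.

Lemma imul_ideal_int I J : ideal_int I -> ideal_int J -> ideal_int (imul I J).
Proof.
move=> [Is [x [Ix x0]] II] [Js [y [Jy y0]] JI]; split.
- exact: imul_submodule.
- by exists (x * y); rewrite mulf_neq0 //; split=> //; apply: imul_mem.
- by apply: imul_sub ring_submodule _ => a b /II Da /JI; apply: ringM.
Qed.

Lemma iprod_ideal_int l : (forall I, List.In I l -> ideal_int I) -> ideal_int (iprod D l).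
Proof.
elim: l => [|I l IHl] lI; first exact: ring_ideal_int.
apply: imul_ideal_int; first by apply: lI; left.
by apply: IHl => J Jl; apply: lI; right.
Qed.

Lemma ipow_ideal_int I n : ideal_int I -> ideal_int (ipow D I n).
Proof.
move=> HI; elim: n => [|n IHn]; first exact: ring_ideal_int.
exact: imul_ideal_int.
Qed.

Lemma ipow_mem I x n : I x -> ipow D I n (x ^+ n).
Proof.
move=> Ix; elim: n => [|n IHn]; first by rewrite expr0; apply: ring1.
by rewrite exprS; apply: imul_mem.
Qed.

(** Multiplying the denominators of the generators clears them all; this is what makes a nonzero
    finitely generated module a fractional ideal. *)
Lemma common_denominator s : frac_field D ->
  exists d, [/\ D d, d != 0 & forall x, span D s x -> D (d * x)].
Proof.
move=> HK.
suff [d [dD d0 ds]] : exists d, [/\ D d, d != 0 & forall x, x \in s -> D (d * x)].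
  exists d; split=> // x; suff /[apply] : subk (span D s) (fun y => D (d * y)) by [].
  apply: span_sub => //; split.
  - by rewrite mulr0; apply: ring0.
  - by move=> a b da db; rewrite mulrDr; apply: ringD.
  - by move=> e a eD da; rewrite mulrCA; apply: ringM.
elim: s => [|x s [d [dD d0 ds]]].
  by exists 1; rewrite oner_neq0; split=> //; apply: ring1.
have [a [b [aD bD b0 ->]]] := HK x.
exists (d * b); split; rewrite ?mulf_neq0 //; first exact: ringM.
move=> y; rewrite inE => /orP [/eqP -> | /ds dy].
  by rewrite -mulrA (mulrC b) divfK //; apply: ringM.
by rewrite mulrAC; apply: ringM.
Qed.

End Subring.

(** * Primes with a discrete valuation ring as localization *)

Definition off (K : fieldType) (D P : kset K) (x : K) := D x /\ ~ P x.

(* [uniformizer D P p] expresses, without mentioning [D_P], that [p] generates the maximal ideal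
   of a discrete valuation ring [D_P]: every nonzero [x] is [p ^+ n] times a unit [e / s]. *)
Definition uniformizer (K : fieldType) (D P : kset K) (p : K) :=
  [/\ P p, p != 0 & forall x, D x -> x != 0 ->
      exists n s e, [/\ off D P s, off D P e & s * x = p ^+ n * e]].

Section Prime.
Variables (K : fieldType) (D P : kset K).
Hypotheses (HD : is_subring D) (HP : prime_ideal D P).

Lemma prime_submodule : is_submodule D P. Proof. by case: HP. Qed.

Lemma prime_integral x : P x -> D x. Proof. by case: HP => _ + _ _; apply. Qed.

Lemma prime_mulr d x : D d -> P x -> P (d * x).
Proof. by case: prime_submodule => _ _; apply. Qed.

Lemma prime_proper : ~ P 1.
Proof. by case: HP => Psub PD Pne _ P1; apply: Pne; apply: submodule_eq_ring. Qed.

Lemma off_neq0 x : off D P x -> x != 0.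
Proof. by move=> [_ nPx]; apply/eqP => x0; apply: nPx; rewrite x0; case: prime_submodule. Qed.

Lemma off1 : off D P 1.
Proof. by split; [apply: ring1 | apply: prime_proper]. Qed.

Lemma offM x y : off D P x -> off D P y -> off D P (x * y).
Proof.
move=> [Dx nx] [Dy ny]; split; first exact: ringM.
by case: HP => _ _ _ Pp /(Pp _ _ Dx Dy) [].
Qed.

Lemma off_cancel s x : off D P s -> D x -> P (s * x) -> P x.
Proof. by move=> [Ds ns] Dx; case: HP => _ _ _ Pp /(Pp _ _ Ds Dx) []. Qed.

(** Finitely many denominators of [D_P] have a common multiple off [P]. Together with finite
    character, this transfers star-closure to ideals defined by a local condition. *)
Lemma off_common_multiplier (I : kset K) (t : seq K) : is_submodule D I ->
  (forall x, x \in t -> exists2 s, off D P s & I (s * x)) ->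
  exists2 s, off D P s & forall x, x \in t -> I (s * x).
Proof.
move=> [_ _ IM]; elim: t => [|x t IHt] tI; first by exists 1; [apply: off1|].
have [s os Isx] : exists2 s, off D P s & I (s * x) by apply: tI; rewrite mem_head.
have [y yt|r orr Ir] := IHt; first by apply: tI; rewrite inE yt orbT.
exists (r * s); first exact: offM.
move=> y; rewrite inE => /orP [/eqP -> | /Ir Iry].
  by rewrite -mulrA; apply: IM => //; case: orr.
by rewrite mulrAC mulrC; apply: IM => //; case: os.
Qed.

(** Up to [u], a unit of [D_P], multiplication by [a] is division by [p], and it maps [P] into [D].
    Hence [x] can be divided by [p] as long as it stays in [P]; the relation [p ^+ m * b = x * d]
    bounds the number of divisions by [m]. *)
Lemma uniformizer_of_cofactor (p a u : K) :
    P p -> a * p = u -> off D P u -> (forall x, P x -> D (a * x)) ->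
    (forall x, D x -> x != 0 -> exists m b d, [/\ off D P b, D d & p ^+ m * b = x * d]) ->
  uniformizer D P p.
Proof.
move=> Pp apu ou aP div; have Dp := prime_integral Pp.
have p0 : p != 0.
  by apply/eqP => p0; have := off_neq0 ou; rewrite -apu p0 mulr0 eqxx.
split=> // x Dx x0; have [m [b [d [ob Dd E]]]] := div x Dx x0.
elim: m x b {x0 div} Dx ob E => [|m IHm] x b Dx ob E.
  exists 0%N, 1, x; rewrite expr0; split; [exact: off1| |by []].
  split=> // Px; case: ob => _; apply; rewrite -[b]mul1r -(expr0 p) E mulrC.
  exact: prime_mulr.
have [Px|nPx] := classic (P x); last first.
  by exists 0%N, 1, x; rewrite expr0; split; [exact: off1| |].
(* Cancelling one [p] turns the bound [m.+1] for [x] into the bound [m] for [a * x], at the cost of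
   the factor [u] off [P]. *)
have E' : p ^+ m * (u * b) = a * x * d.
  apply: (mulfI p0); transitivity (u * (p ^+ m.+1 * b)); first by rewrite exprS; ring.
  by rewrite E -apu; ring.
have [n [s [e [os oe F]]]] := IHm _ _ (aP _ Px) (offM ou ob) E'.
exists n.+1, (s * u), e; split=> //; first exact: offM.
transitivity (p * (s * (a * x))); first by rewrite -apu; ring.
by rewrite F exprS mulrA.
Qed.

(** * Height and valuation of a prime with a uniformizer *)

Section Uniformizer.
Variable p : K.
Hypothesis Hp : uniformizer D P p.

Lemma unif_neq0 : p != 0. Proof. by case: Hp. Qed.

Lemma unif_ring : D p. Proof. by case: Hp => /prime_integral. Qed.

Lemma unif_mul_prime n x : D x -> P (p ^+ n.+1 * x).
Proof.
move=> Dx; rewrite exprS -mulrA mulrC; apply: prime_mulr; last by case: Hp.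
by apply: ringM => //; apply: ringX => //; apply: unif_ring.
Qed.

(** An exponent 0 would give [e = s * x] in [P], although [e] is off [P]. *)
Lemma unif_prime_decomp x : P x -> x != 0 ->
  exists n s e, [/\ off D P s, off D P e & s * x = p ^+ n.+1 * e].
Proof.
case: Hp => Pp p0 Hdec Px x0.
have [[|n] [s [e [os oe E]]]] := Hdec x (prime_integral Px) x0; last by exists n, s, e.
case: oe => _ []; rewrite -[e]mul1r -(expr0 p) -E.
by apply: prime_mulr => //; case: os.
Qed.

(** A nonzero [y] in [Q] satisfies [s * y = p ^+ n.+1 * e] with [e] off [P], hence off [Q], so the
    prime [Q] contains [p]. Every element of [P] is a multiple of [p] up to a factor off [P], hence
    lies in [Q] as well. *)
Lemma unif_height_one : height_one D P.
Proof.
case: Hp => Pp p0 Hdec; split=> //.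
  by move=> PZ; move: Pp; rewrite PZ => /eqP; rewrite (negPf p0).
move=> Q HQ QP; have [Qn0|Q0] := classic (exists2 y, Q y & y != 0); last first.
  left; apply: kset_ext => y; last by move->; case: HQ => [[]].
  by move=> Qy; apply: NNPP => y0; apply: Q0; exists y => //; apply/eqP.
right; apply: kset_ext => // q Pq; case: Qn0 => y Qy y0.
have Q0 : Q 0 by case: HQ => [[]].
have [_ QD _ Qprime] := HQ.
have [->//|q0] := eqVneq q 0.
have powQ n : Q (p ^+ n.+1) -> Q p.
  elim: n => [|n IHn]; first by rewrite expr1.
  rewrite exprS => /Qprime [] //; first exact: unif_ring.
  by apply: ringX => //; apply: unif_ring.
have QM d x : D d -> Q x -> Q (d * x) by case: HQ => [[_ _ +] _ _ _]; apply.
have Qp : Q p.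
  have [n [s [e [[Ds ns] [De ne] E]]]] := unif_prime_decomp (QP _ Qy) y0.
  have := QM _ _ Ds Qy; rewrite E => /Qprime [] //; last by move/QP.
  - by apply: ringX => //; apply: unif_ring.
  - exact: powQ.
have [n [s [e [[Ds ns] [De ne] E]]]] := unif_prime_decomp Pq q0.
have : Q (s * q).
  rewrite E exprSr mulrAC; apply: QM => //; apply: ringM => //.
  by apply: ringX => //; apply: unif_ring.
by move/(Qprime _ _ Ds (prime_integral Pq)) => [/QP|].
Qed.

(** The statement that [x] has [p]-adic value [n], kept as a relation until existence and uniqueness
    are known. The integer exponent covers all nonzero elements of [K]. *)
Let val_rel (x : K) (n : int) :=
  exists s e, [/\ off D P s, off D P e & s * x = p ^ n * e].

Let val_relM x y m n : val_rel x m -> val_rel y n -> val_rel (x * y) (m + n).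
Proof.
move=> [s [e [os oe E]]] [t [f [ot oof F]]].
exists (s * t), (e * f); split; [exact: offM|exact: offM|].
by rewrite expfzDr ?unif_neq0 // mulrACA E F mulrACA.
Qed.

Let val_rel_ring x : D x -> x != 0 -> exists n : nat, val_rel x n%:Z.
Proof.
case: Hp => _ _ Hdec Dx x0; have [n [s [e H]]] := Hdec x Dx x0.
by exists n, s, e.
Qed.

Let val_rel_inv x n : val_rel x n -> val_rel x^-1 (- n).
Proof.
move=> [s [e [os oe E]]]; exists e, s; split=> //.
have [s0 e0] := (off_neq0 os, off_neq0 oe).
have pn0 : p ^ n != 0 by rewrite expfz_neq0 // unif_neq0.
have x0 : x != 0.
  by apply/eqP => x0; move/eqP: E; rewrite x0 mulr0 eq_sym mulf_eq0 (negPf pn0) (negPf e0).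
have Es : s = p ^ n * e / x by rewrite -E mulfK.
rewrite -invr_expz Es; by field; rewrite x0 pn0.
Qed.

Let val_rel_off x : off D P x -> val_rel x 0.
Proof. by move=> ox; exists 1, x; split=> //; apply: off1. Qed.

(** Comparing the two representations and cancelling [p ^ m] would make [t * e], a product of
    elements off [P], a multiple of [p]. *)
Let val_rel_lt x m n : val_rel x m -> val_rel x n -> ~ m < n.
Proof.
move=> [s [e [os oe E]]] [t [f [ot oof F]]].
rewrite -subr_gt0; case En: (n - m) => [[|k]|//] // _.
have {En} En : n = m + k.+1 by rewrite -En addrC subrK.
have G : p ^ m * (t * e) = p ^ m * (p ^+ k.+1 * (s * f)).
  rewrite mulrCA -E mulrCA F En expfzDr ?unif_neq0 // -exprnP; ring.
have pm0 : p ^ m != 0 by rewrite expfz_neq0 // unif_neq0.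
case: (offM ot oe) => _ []; rewrite (mulfI pm0 G).
by apply: unif_mul_prime; case: (offM os oof).
Qed.

Let val_rel_uniq x m n : val_rel x m -> val_rel x n -> m = n.
Proof.
move=> Hm Hn; case: (ltgtP m n) => // h.
- by case: (val_rel_lt Hm Hn).
- by case: (val_rel_lt Hn Hm).
Qed.

(** Writing the larger value as [m + k] lets [p ^ m] be factored out of the sum; the remaining
    cofactor [g] lies in [D], so its value is a natural number. *)
Let val_relD x y m (k : nat) :
  x + y != 0 -> val_rel x m -> val_rel y (m + k%:Z) -> exists j : nat, val_rel (x + y) (m + j%:Z).
Proof.
move=> xy0 [s [e [os oe E]]] [t [f [ot oof F]]].
have p0 := unif_neq0; have pm0 : p ^ m != 0 by rewrite expfz_neq0.
have ost := offM os ot.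
pose g := t * e + p ^+ k * s * f.
have G : s * t * (x + y) = p ^ m * g.
  transitivity (t * (s * x) + s * (t * y)); first by ring.
  by rewrite E F expfzDr // -exprnP /g; ring.
have Dg : D g.
  case: os ot oe oof => [Ds _] [Dt _] [De _] [Df _].
  apply: ringD => //; first exact: ringM.
  apply: ringM => //; apply: ringM => //.
  by apply: ringX => //; apply: unif_ring.
have g0 : g != 0.
  apply/eqP => g0; move/eqP: G; rewrite g0 mulr0 mulf_eq0 (negPf xy0).
  by rewrite (negPf (off_neq0 ost)).
have [j [r [h [orr oh H]]]] := val_rel_ring Dg g0.
exists j, (r * (s * t)), h; split=> //; first exact: offM.
by rewrite -mulrA G expfzDr // mulrCA H mulrA.
Qed.

Lemma unif_dvr : frac_field D -> rank_one_dvr (localization D P).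
Proof.
move=> HK.
(* The condition [x != 0] sits under the quantifier so that the choice below gives a total function;
   its value at 0 is arbitrary. *)
have ex x : exists n, x != 0 -> val_rel x n.
  have [->|x0] := eqVneq x 0; first by exists 0.
  have [a [b [Da Db b0 E]]] := HK x.
  have a0 : a != 0 by apply: contraNneq x0 => a0; rewrite E a0 mul0r.
  have [m Hm] := val_rel_ring Da a0; have [n Hn] := val_rel_ring Db b0.
  by exists (m%:Z - n%:Z) => _; rewrite E; apply: val_relM => //; apply: val_rel_inv.
pose v x := epsilon (inhabits (0 : int)) (fun n => x != 0 -> val_rel x n).
have vP x : x != 0 -> val_rel x (v x) by exact: (epsilon_spec _ _ (ex x)).
have vE x n : x != 0 -> val_rel x n -> v x = n.
  by move=> x0; apply: val_rel_uniq; apply: vP.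
have vD x y : x != 0 -> y != 0 -> x + y != 0 -> v x <= v y -> v x <= v (x + y).
  move=> x0 y0 xy0 le; have := vP y y0.
  have -> : v y = v x + `|v y - v x|%N%:Z by rewrite gez0_abs ?subr_ge0 // addrCA subrr addr0.
  by case/(val_relD xy0 (vP x x0)) => j /(vE _ _ xy0) ->; rewrite lerDl.
exists v; split.
- by move=> x y x0 y0; apply: vE; rewrite ?mulf_neq0 //; apply: val_relM; apply: vP.
- move=> x y x0 y0 xy0; case: (leP (v x) (v y)) => h; first exact: vD.
  by rewrite addrC; apply: vD; rewrite 1?addrC // ltW.
- exists p; split; first exact: unif_neq0.
  apply: vE; first exact: unif_neq0.
  by exists 1, 1; split; rewrite ?expr1z ?mulr1 ?mul1r //; apply: off1.
- move=> x; split.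
  + move=> [a [s [Da Ds ns ->]]]; have [->|a0] := eqVneq a 0; first by left; rewrite mul0r.
    have os : off D P s by [].
    have x0 : a / s != 0 by rewrite mulf_neq0 // invr_neq0 // off_neq0.
    right; split=> //; have [n Hn] := val_rel_ring Da a0.
    rewrite (vE _ n%:Z x0) // -[n%:Z]subr0.
    by apply: val_relM => //; apply: val_rel_inv; apply: val_rel_off.
  + case=> [->|[x0]].
      exists 0, 1; rewrite mul0r; case: off1 => D1 n1.
      by split=> //; apply: ring0.
    have := vP x x0; case: (v x) => // n [s [e [os oe E]]] _.
    exists (p ^+ n * e), s; case: (os) => Ds ns; split=> //.
      by apply: ringM; [| apply: ringX => //; apply: unif_ring | case: oe].
    by rewrite exprnP -E mulrAC mulfV ?mul1r // off_neq0.
Qed.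

End Uniformizer.

(** Among nonzero elements of [D], those off [P] are exactly those of value 0. So the numerator [p]
    of an element of value 1 again has value 1, and dividing [x] by [p] to the power [v x] leaves a
    fraction of value 0 whose numerator is off [P]. *)
Lemma dvr_uniformizer : rank_one_dvr (localization D P) -> exists p, uniformizer D P p.
Proof.
move=> [v [vM _ [t [t0 vt]] vV]].
have v1 : v 1 = 0.
  by apply: (addrI (v 1)); rewrite -vM ?oner_neq0 // mulr1 addr0.
have vV' x : x != 0 -> v x^-1 = - v x.
  by move=> x0; apply: (addrI (v x)); rewrite -vM ?invr_neq0 // mulfV // v1 subrr.
have vD x : D x -> x != 0 -> 0 <= v x.
  move=> Dx x0; have : localization D P x.
    by exists x, 1; rewrite divr1; case: off1.
  by move/vV => [/eqP|[]//]; rewrite (negPf x0).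
have voff x : off D P x -> v x = 0.
  move=> ox; have x0 := off_neq0 ox; apply/eqP; rewrite eq_le vD ?andbT //; last by case: ox.
  have : localization D P x^-1.
    by exists 1, x; case: ox => Dx nx; rewrite mul1r; split=> //; apply: ring1.
  by move/vV => [/eqP|[_]]; rewrite ?invr_eq0 ?(negPf x0) // vV' // oppr_ge0.
(* Value 0 puts the inverse of [x] in [D_P], say as [a / s]; then [s = a * x] would lie in [P]
   together with [x]. *)
have offv x : D x -> x != 0 -> v x = 0 -> off D P x.
  move=> Dx x0 vx; split=> // Px.
  have : localization D P x^-1 by apply/vV; right; rewrite invr_eq0 vV' // vx.
  move=> [a [s [Da Ds ns E]]].
  have s0 : s != 0 by apply: off_neq0 (conj Ds ns).
  apply: ns.
  suff -> : s = a * x by apply: prime_mulr.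
  by rewrite -[a](divfK s0) -E mulrAC mulVf // mul1r.
have : localization D P t by apply/vV; right; rewrite vt.
move=> [p [s [Dp Ds ns Et]]]; have os : off D P s by [].
have s0 := off_neq0 os.
have p0 : p != 0 by apply: contraNneq t0 => p0; rewrite Et p0 mul0r.
have vp : v p = 1.
  by rewrite -vt Et vM ?invr_neq0 // vV' // (voff s os) subr0.
have Pp : P p by apply: NNPP => np; have := voff p (conj Dp np); rewrite vp.
have vpX n : v (p ^+ n) = n%:Z.
  by elim: n => [|n IHn]; rewrite ?expr0 // exprS vM ?expf_neq0 // IHn vp -intS.
exists p; split=> // x Dx x0.
have := vD x Dx x0; case Evx: (v x) => [n|//] _; exists n.
have px0 : x / p ^+ n != 0 by rewrite mulf_neq0 // invr_neq0 // expf_neq0.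
have vx : v (x / p ^+ n) = 0.
  by rewrite vM ?invr_neq0 ?expf_neq0 // vV' ?expf_neq0 // vpX Evx subrr.
have : localization D P (x / p ^+ n) by apply/vV; right; rewrite vx.
move=> [e [r [De Dr nr E]]]; have orr : off D P r by [].
have r0 := off_neq0 orr.
have Ee : e = x / p ^+ n * r by rewrite E divfK.
exists r, e; split=> //; last by rewrite Ee; field; rewrite expf_neq0.
apply: offv => //; first by rewrite Ee mulf_neq0.
by rewrite Ee vM // vx (voff r orr).
Qed.

End Prime.

Lemma ex_least (A : nat -> Prop) :
  (exists n, A n) -> exists n, A n /\ forall m, A m -> (n <= m)%N.
Proof.
move=> [n An]; pose a m := if excluded_middle_informative (A m) then true else false.
have aP m : a m <-> A m by rewrite /a; case: excluded_middle_informative.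
have exa : exists m, a m by exists n; apply/aP.
case: (ex_minnP exa) => m /aP Am min_m.
by exists m; split=> // k /aP; apply: min_m.
Qed.

(** * Star operations *)

Section StarOperation.
Variables (K : fieldType) (D : kset K) (star : kset K -> kset K).
Hypotheses (HD : is_subring D) (HK : frac_field D) (Hstar : is_star_op D star).
Implicit Types (A B I J L M N P : kset K) (l : seq (kset K)).

Lemma star_frac I : is_frac_ideal D I -> is_frac_ideal D (star I).
Proof. by case: Hstar => + _; apply. Qed.

Lemma sub_star I : is_frac_ideal D I -> subk I (star I).
Proof. by case: Hstar => _ [_ _ + _ _]; apply. Qed.

Lemma star_mono I J :
  is_frac_ideal D I -> is_frac_ideal D J -> subk I J -> subk (star I) (star J).
Proof. by case: Hstar => _ [_ _ _ + _]; apply. Qed.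

Lemma star_ideal_star I : is_frac_ideal D I -> star_ideal D star (star I).
Proof. by move=> HI; split; [apply: star_frac | case: Hstar => _ [_ _ _ _ +]; apply]. Qed.

Lemma star_least I A : is_frac_ideal D I -> star_ideal D star A -> subk I A -> subk (star I) A.
Proof. by move=> HI [HA EA] IA; rewrite -EA; apply: star_mono. Qed.

Lemma star_idealI A : is_frac_ideal D A -> subk (star A) A -> star_ideal D star A.
Proof. by move=> HA sA; split=> //; apply: kset_ext => //; apply: sub_star. Qed.

Lemma star_ideal_principal x : x != 0 -> is_frac_ideal D (principal D x) ->
  star_ideal D star (principal D x).
Proof. by move=> x0 Hx; split=> //; case: Hstar => _ [+ _ _ _ _]; apply. Qed.

Lemma star_ideal_ring : star_ideal D star D.
Proof.
have := @star_ideal_principal 1 (oner_neq0 _); rewrite ring_principal //; apply.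
exact: ring_frac.
Qed.

Lemma star_ideal_int A : star_ideal D star A -> integral D A -> ideal_int D A.
Proof. by move=> [[As An _] _] AD. Qed.

Lemma star_int I : ideal_int D I -> ideal_int D (star I).
Proof.
move=> HI; have [Is In _] := star_frac (ideal_int_frac HD HI); split=> //.
apply: star_least; [exact: ideal_int_frac|exact: star_ideal_ring|by case: HI].
Qed.

Lemma star_eq_ring I : ideal_int D I -> star I = D <-> star I 1.
Proof.
move=> /star_int [Is _ II]; split; first by move->; apply: ring1.
exact: submodule_eq_ring.
Qed.

Lemma scale_frac x I : x != 0 -> is_frac_ideal D I -> is_frac_ideal D (scale x I).
Proof.
move=> x0 [Is [y [Iy y0]] [d [Dd d0 dI]]]; split; first exact: scale_submodule.
  by exists (x * y); rewrite mulf_neq0 //; split=> //; exists y.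
have [a [b [Da Db b0 E]]] := HK x; exists (b * d).
rewrite mulf_neq0 //; split=> //; first exact: ringM.
move=> _ [z [Iz ->]]; have -> : b * d * (x * z) = a * (d * z) by rewrite E; field.
by apply: ringM => //; apply: dI.
Qed.

(** If [xI] lies in the star-ideal [A], so does its star closure, which is [x] times that of [I].
    Elementwise, this replaces the rule that a factor of a star-product may be replaced by its
    closure. The case [x = 0] is separate because [star] commutes only with nonzero scalings. *)
Lemma star_transport x I A : is_frac_ideal D I -> star_ideal D star A ->
  (forall y, I y -> A (x * y)) -> forall y, star I y -> A (x * y).
Proof.
move=> HI HA xIA y; have [->|x0] := eqVneq x 0.
  by rewrite mul0r; case: HA => [[[]]].
move=> Iy; have : subk (star (scale x I)) A.
  apply: star_least => //; first exact: scale_frac.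
  by move=> _ [z [Iz ->]]; apply: xIA.
have -> : star (scale x I) = scale x (star I).
  by case: Hstar => _ [_ + _ _ _]; apply.
by apply; exists y.
Qed.

Lemma transport_submodule x A : is_submodule D A -> is_submodule D (fun y => A (x * y)).
Proof.
move=> [A0 AA AM]; split.
- by rewrite mulr0.
- by move=> y z Ay Az; rewrite mulrDr; apply: AA.
- by move=> d y Dd Ay; rewrite mulrCA; apply: AM.
Qed.

Lemma iadd_principal_int I x : ideal_int D I -> D x -> ideal_int D (iadd I (principal D x)).
Proof.
move=> [Is [y [Iy y0]] II] Dx.
have Xs : is_submodule D (principal D x) := scale_submodule _ (ring_submodule HD).
split; first exact: iadd_submodule.
- by exists y; split=> //; apply: (iaddl Xs).
- apply: iadd_sub; [exact: ring_submodule|by []|].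
  by move=> _ [d [Dd ->]]; apply: ringM.
Qed.

Lemma iadd_principal_mem I x : is_submodule D I -> iadd I (principal D x) x.
Proof.
move=> Is; apply: (iaddr Is); exists 1; rewrite mulr1; split=> //; exact: ring1.
Qed.

(** * Maximal star-ideals are prime *)

Section Maximal.
Variable M : kset K.
Hypothesis HM : max_star_ideal D star M.

Lemma max_int : ideal_int D M.
Proof. by case: HM => sM MD _ _; apply: star_ideal_int. Qed.

(** If [a] is not in [M], maximality gives 1 in the star closure of [M + aD]. Since [b] maps
    [M + aD] into [M], it maps that closure into [M], so [b] is in [M]. *)
Lemma max_prime : prime_ideal D M.
Proof.
have [sM MD Mne Mmax] := HM; have [Ms _ _] := max_int; split=> // a b Da Db Mab.
apply: NNPP => nMab; apply: Mne.
have {nMab} [na nb] : ~ M a /\ ~ M b by split=> h; apply: nMab; [left|right].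
have Nint := iadd_principal_int max_int Da; have Nfrac := ideal_int_frac HD Nint.
have [_ _ NI] := star_int Nint.
case: nb; rewrite -[b]mulr1.
apply: (star_transport Nfrac sM).
  move=> _ [m [_ [Mm [d [Dd ->]] ->]]]; rewrite mulrDr.
  have [_ MA MM] := Ms; apply: MA; first exact: MM.
  by have -> : b * (a * d) = d * (a * b) by [ring]; apply: MM.
apply/(star_eq_ring Nint); apply: NNPP => Nne; apply: na.
rewrite -(Mmax _ (star_ideal_star Nfrac) NI Nne).
  exact: (sub_star Nfrac (iadd_principal_mem _ Ms)).
move=> m Mm; apply: (sub_star Nfrac); apply: (iaddl _ Mm).
exact: (scale_submodule _ (ring_submodule HD)).
Qed.

Lemma max_off_unit x y : D x -> x * y = 1 -> D y -> ~ M x.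
Proof.
move=> Dx xy Dy Mx; apply: (prime_proper max_prime); rewrite -xy mulrC.
exact: prime_mulr max_prime _ _ _ _.
Qed.

Lemma max_sub_eq N : max_star_ideal D star N -> subk M N -> N = M.
Proof. by case: HM => _ _ _ + [sN NI Nne _]; apply. Qed.

End Maximal.

Lemma prime_over_iprod P l : prime_ideal D P -> (forall I, List.In I l -> ideal_int D I) ->
  subk (iprod D l) P -> exists2 I, List.In I l & subk I P.
Proof.
move=> HP; elim: l => [|I l IHl] lD lP.
  by case: (prime_proper HP); apply: lP; apply: ring1.
have [IP|nIP] := classic (subk I P); first by exists I => //; left.
have [a Ia na] : exists2 a, I a & ~ P a.
  by apply: NNPP => na; apply: nIP => a Ia; apply: NNPP => nPa; apply: na; exists a.
have lD' J : List.In J l -> ideal_int D J by move=> Jl; apply: lD; right.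
have [//||J Jl JP] := IHl; last by exists J => //; right.
move=> b lb; apply: (off_cancel HP (s := a)); last by apply: lP; apply: imul_mem.
  by split=> //; have [_ _] := lD I (or_introl erefl); apply.
by have [_ _] := iprod_ideal_int HD lD'; apply.
Qed.

Lemma prime_over_ipow P M n : prime_ideal D P -> ideal_int D M ->
  subk (ipow D M n) P -> subk M P.
Proof.
move=> HP HM MP.
have inM I : List.In I (nseq n M) -> I = M.
  by elim: n {MP} => [//|n IHn] /= [].
have [|I /inM -> //] := prime_over_iprod HP _ MP.
by move=> I /inM ->.
Qed.

Lemma homog_int I : star_homog D star I -> ideal_int D I.
Proof. by case=> sI II _ _ _; apply: star_ideal_int. Qed.

(** * Type 2 factorizations at a fixed maximal star-ideal *)

Section TypeTwo.
Variables (P : kset K) (l : seq (kset K)).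
Hypotheses (HP : max_star_ideal D star P)
           (Hl : forall I, List.In I l -> star_homog_type2 D star I).

Lemma type2_ideal_int I : List.In I l -> ideal_int D I.
Proof. by move=> /Hl [/homog_int]. Qed.

(** The maximal star-ideal [M] of which [I] is a power must be [P]: a power of [M] lies in the prime
    [P], so [M] does, and maximality gives equality. *)
Lemma type2_sub_max I : List.In I l -> subk I P -> exists n, I = star (ipow D P n.+1).
Proof.
move=> /Hl [_ [M [[|n] [HM _ n0 EI]]]] IP; first by [].
rewrite {}EI in IP *.
have Mint := max_int HM; have Mn := ipow_ideal_int HD n.+1 Mint.
exists n; rewrite (max_sub_eq HM HP) //.
apply: (@prime_over_ipow _ _ n.+1 (max_prime HP) Mint) => x Mx.
by apply: IP; apply: sub_star => //; apply: ideal_int_frac.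
Qed.

(* If [(D : P) P] were contained in [P], a factor [P ^ n] would allow the improvement from
   [y * iprod l <= D] to [y * iprod l <= P]; taking [y = 1 / x] for [xD = (iprod l)^*] this is absurd.
   Hence maximal star-ideals dividing a principal ideal are star-invertible. *)
Lemma cofactor_transport n y :
  (forall a, (forall q, P q -> D (a * q)) -> forall q, P q -> P (a * q)) ->
  List.In (star (ipow D P n.+1)) l ->
  (forall z, iprod D l z -> D (y * z)) -> forall z, iprod D l z -> P (y * z).
Proof.
move=> triv; have := type2_ideal_int.
have sP : star_ideal D star P by case: HP.
have [Ps _ _] := max_int HP.
have Pn := ipow_ideal_int HD n.+1 (max_int HP).
have Pnfrac := ideal_int_frac HD Pn.
elim: l y => [|I k IHk] y //= kint kn yD.
apply: imul_sub; first exact: transport_submodule.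
move=> i j Ii kj.
have kint' J : List.In J k -> ideal_int D J by move=> Jk; apply: kint; right.
case: kn => [EI|kn]; last first.
  rewrite mulrA; apply: (IHk) => // z kz; rewrite -mulrA; apply: yD.
  exact: imul_mem.
have -> : y * (i * j) = y * j * i by ring.
move: i Ii; rewrite EI; apply: star_transport => //.
apply: imul_sub; first exact: transport_submodule.
(* One factor [p] of the power of [P] is singled out: [y * j * q] maps all of [P] into [D], hence
   into [P] by [triv]. *)
move=> p q Pp Pq; have -> : y * j * (p * q) = y * j * q * p by ring.
apply: triv Pp => r Pr; have -> : y * j * q * r = y * (r * q * j) by ring.
apply: yD; apply: imul_mem => //; rewrite EI.
by apply: sub_star => //; apply: imul_mem.
Qed.

(** The pair [a], [p] shows that [(D : P) P] is not inside [P]; it is the cofactor data from which a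
    uniformizer is built. *)
Lemma max_invertible x : P x -> x != 0 -> principal D x = star (iprod D l) ->
  exists a p, [/\ P p, forall q, P q -> D (a * q) & off D P (a * p)].
Proof.
move=> Px x0 Exl; have HPp := max_prime HP; have Dx := prime_integral HPp Px.
have lint := iprod_ideal_int HD type2_ideal_int.
have lfrac := ideal_int_frac HD lint.
have lx : subk (iprod D l) (principal D x) by rewrite Exl; apply: sub_star.
have [I Il IP] : exists2 I, List.In I l & subk I P.
  apply: prime_over_iprod => // [|z /lx]; first exact: type2_ideal_int.
  by move=> [d [Dd ->]]; rewrite mulrC; apply: prime_mulr HPp _ _ _ _.
have [n En] := type2_sub_max Il IP; rewrite {}En in Il.
apply: NNPP => nex.
have triv a : (forall q, P q -> D (a * q)) -> forall q, P q -> P (a * q).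
  move=> aD q Pq; apply: NNPP => naq; apply: nex; exists a, q; split=> //.
  by split=> //; apply: aD.
have sP : star_ideal D star P by case: HP.
(* Here 1 is the inverse of [x] times [x], and [x] lies in the star closure of the product, so the
   improvement from [D] to [P] would give 1 in [P]. *)
apply: (prime_proper HPp); rewrite -(mulVf x0).
apply: (star_transport lfrac sP).
  apply: cofactor_transport Il _ => // z /lx [d [Dd ->]].
  by rewrite mulKf.
by rewrite -Exl; exists 1; rewrite mulr1; split=> //; apply: ring1.
Qed.

(** A factor inside [P] is the closure of a power of [P] and contains a power of [p]; any other
    factor contains an element off [P]. The required element is the product of these choices. *)
Lemma iprod_type2_mem p : P p -> exists m b, off D P b /\ iprod D l (p ^+ m * b).
Proof.
move=> Pp; have HPp := max_prime HP; have := type2_sub_max; have := type2_ideal_int.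
elim: l => [|I k IHk] kint ksub.
  by exists 0%N, 1; rewrite mul1r; split; [apply: off1 | apply: ring1].
have [||m [b [ob kb]]] := IHk; [by move=> J Jk; apply: kint; right|
  by move=> J Jk; apply: ksub; right|].
have [IP|nIP] := classic (subk I P).
  have [n En] := ksub I (or_introl erefl) IP.
  exists (n.+1 + m)%N, b; split=> //; rewrite exprD -mulrA; apply: imul_mem => //.
  rewrite En; apply: sub_star; last exact: ipow_mem.
  by apply/(ideal_int_frac HD)/(ipow_ideal_int HD)/max_int.
have [a Ia na] : exists2 a, I a & ~ P a.
  by apply: NNPP => na; apply: nIP => a Ia; apply: NNPP => nPa; apply: na; exists a.
exists m, (a * b); split; last by rewrite mulrCA; apply: imul_mem.
apply: offM => //; split=> //.
by have [_ _] := kint I (or_introl erefl); apply.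
Qed.

End TypeTwo.

Lemma SH_type2_uniformizer P : star_SH_type2 D star -> max_star_ideal D star P ->
  exists p, uniformizer D P p.
Proof.
move=> HSH HP; have HPp := max_prime HP.
have [_ [x [Px x0]] PD] := max_int HP.
have [|l [Hl Exl]] := HSH x (PD x Px) x0.
  by move=> [y [Dy xy]]; apply: (max_off_unit HP (PD x Px) xy Dy).
have [a [p [Pp aP oap]]] := max_invertible HP Hl Px x0 Exl.
exists p; apply: (uniformizer_of_cofactor HD HPp Pp (erefl (a * p)) oap aP).
move=> y Dy y0; have [[z [Dz yz]]|nu] := classic (is_unit_in D y).
  by exists 0%N, 1, z; rewrite mulr1 expr0 yz; split=> //; apply: off1.
have [k [Hk Eyk]] := HSH y Dy y0 nu.
have [m [b [ob kb]]] := iprod_type2_mem HP Hk Pp.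
(* This closure is [yD], so [y] divides a power of [p] times an element off [P], as
   [uniformizer_of_cofactor] requires. *)
have : star (iprod D k) (p ^+ m * b).
  apply: sub_star => //; apply/(ideal_int_frac HD)/(iprod_ideal_int HD).
  exact: type2_ideal_int Hk.
by rewrite -Eyk => -[d [Dd E]]; exists m, b, d.
Qed.

Lemma SH_type2_SH : star_SH_type2 D star -> star_SH D star.
Proof.
move=> HSH x Dx x0 nu; have [l [Hl Exl]] := HSH x Dx x0 nu.
by exists l; split=> // I /Hl [].
Qed.

Theorem SH_type2_Krull : star_SH_type2 D star -> star_Krull D star.
Proof.
move=> HSH; split; first split; first exact: SH_type2_SH.
- move=> P HP; have [p Hp] := SH_type2_uniformizer HSH HP.
  exact: (unif_height_one HD (max_prime HP) Hp).
- move=> P HP; have [p Hp] := SH_type2_uniformizer HSH HP.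
  exact: (unif_dvr HD (max_prime HP) Hp HK).
Qed.

(** * Homogeneous ideals and star operations of finite character *)

Hypothesis Hfc : finite_character D star.

(** * The maximal star-ideal of a star-homogeneous ideal *)

Section HomogMax.
Variables (I : kset K) (g : seq K).
Hypotheses (HI : star_homog D star I) (Eg : I = star (span D g)) (g0 : nonzero (span D g)).

(** The star-ideal generated by [I] and the finite list [t], written through generators [g] of [I]
    so that it is visibly of finite type. *)
Let gen t := star (span D (t ++ g)).

Definition homog_max (x : K) := D x /\ ~ gen [:: x] 1.

Let span_frac t : nonzero (span D t) -> is_frac_ideal D (span D t).
Proof.
move=> t0; split=> //; first exact: span_submodule.
exact: common_denominator.
Qed.

Let g_sub x : x \in g -> I x.
Proof. by move=> xg; rewrite Eg; apply: (sub_star (span_frac g0)); apply: span_mem. Qed.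

Let I_ring x : I x -> D x.
Proof. by have [_ _] := homog_int HI; apply. Qed.

Let gen_int t : (forall x, x \in t -> D x) -> ideal_int D (span D (t ++ g)).
Proof.
move=> tD; split; first exact: span_submodule.
- case: g0 => y [gy y0]; exists y; split=> //; move: y gy {y0}; apply: span_sub.
    exact: span_submodule.
  by move=> x xg; apply: span_mem; rewrite // mem_cat xg orbT.
- apply: span_sub; first exact: ring_submodule.
  by move=> x; rewrite mem_cat => /orP [/tD //|/g_sub /I_ring].
Qed.

Let gen_star t : (forall x, x \in t -> D x) -> star_ideal D star (gen t).
Proof. by move=> tD; apply/star_ideal_star/ideal_int_frac/gen_int. Qed.

Let gen_mem t x : (forall x, x \in t -> D x) -> x \in t ++ g -> gen t x.
Proof.
move=> tD xt; apply: sub_star; last exact: span_mem.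
exact/ideal_int_frac/gen_int.
Qed.

Let gen_sub t A : (forall x, x \in t -> D x) -> star_ideal D star A ->
  (forall x, x \in t -> A x) -> subk I A -> subk (gen t) A.
Proof.
move=> tD sA tA IA; apply: star_least => //; first exact/ideal_int_frac/gen_int.
apply: span_sub; first by case: sA => [[]].
by move=> x; rewrite mem_cat => /orP [/tA //|/g_sub /IA].
Qed.

Let sub_gen t : (forall x, x \in t -> D x) -> subk I (gen t).
Proof.
move=> tD; rewrite Eg; apply: star_least (gen_star tD) _; first exact: span_frac.
apply: span_sub; first by case: (gen_star tD) => [[]].
by move=> x xg; apply: gen_mem => //; rewrite mem_cat xg orbT.
Qed.

Let gen_integral t : (forall x, x \in t -> D x) -> integral D (gen t).
Proof. by move=> tD; case: (star_int (gen_int tD)). Qed.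

(** Induction on [t]: the star-ideals generated by [I] with [x] and by [I] with the rest of the list
    are proper, of finite type and contain [I]. Homogeneity makes the closure of their sum proper,
    and it contains [gen (x :: t)]. *)
Lemma homog_max_gen t : (forall x, x \in t -> homog_max x) -> ~ gen t 1.
Proof.
elim: t => [|x t IHt] tM.
  rewrite /gen /= -Eg => I1; case: HI => _ II _ Ine _; apply: Ine.
  by apply: submodule_eq_ring => //; case: (homog_int HI).
have tD y : y \in x :: t -> D y by move/tM => [].
have tD' y : y \in t -> D y by move=> yt; apply: tD; rewrite inE yt orbT.
have xD y : y \in [:: x] -> D y by rewrite inE => /eqP ->; apply: tD; rewrite mem_head.
have [_ x1] := tM x (mem_head _ _).
have {}IHt : ~ gen t 1 by apply: IHt => y yt; apply: tM; rewrite inE yt orbT.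
have proper u : (forall y, y \in u -> D y) -> ~ gen u 1 -> gen u <> D.
  by move=> uD u1 uE; apply: u1; rewrite uE; apply: ring1.
have ft u : (forall y, y \in u -> D y) -> finite_type D star (gen u).
  by move=> uD; exists (u ++ g); split=> //; case: (gen_int uD).
move=> gen1; case: HI => _ _ _ _ HJL.
apply: (HJL (gen [:: x]) (gen t));
  try by [apply: gen_star|apply: gen_integral|apply: proper|apply: ft|apply: sub_gen].
have [Js Jn JD] := star_int (gen_int xD); have [Ls _ LD] := star_int (gen_int tD').
have JL : ideal_int D (iadd (gen [:: x]) (gen t)).
  split; first exact: iadd_submodule.
    by case: Jn => y [Jy y0]; exists y; split=> //; apply: (iaddl Ls).
  by apply: iadd_sub JD LD; apply: ring_submodule.
have JLf := ideal_int_frac HD JL.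
apply/(star_eq_ring JL); apply: gen_sub gen1 => //; first exact: star_ideal_star.
- move=> y; rewrite inE => /orP [/eqP ->|yt]; apply: (sub_star JLf).
    by apply: (iaddl Ls); apply: gen_mem => //; rewrite mem_head.
  by apply: (iaddr Js); apply: gen_mem => //; rewrite mem_cat yt.
- by move=> y Iy; apply: (sub_star JLf); apply: (iaddl Ls); apply: sub_gen.
Qed.

(** Closure under finitely generated star-ideals: adjoining [x] to [I] stays inside the proper ideal
    [gen t]. Sums, multiples and star-closure all reduce to this. *)
Let homog_max_intro t x : (forall y, y \in t -> homog_max y) -> gen t x -> homog_max x.
Proof.
move=> tM tx; have tD y : y \in t -> D y by move/tM => [].
have Dx := gen_integral tD tx; split=> // x1; apply: (homog_max_gen tM).
apply: gen_sub x1 => //; last exact: sub_gen.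
- by move=> y; rewrite inE => /eqP ->.
- exact: gen_star.
- by move=> y; rewrite inE => /eqP ->.
Qed.

Lemma homog_max_submodule : is_submodule D homog_max.
Proof.
split.
- apply: (@homog_max_intro [::]) => //.
  by have [] : is_submodule D (gen [::]) by case: (@gen_star [::]) => // [[]].
- move=> x y Mx My; have xyM z : z \in [:: x; y] -> homog_max z.
    by rewrite !inE => /orP [/eqP -> | /eqP ->].
  have xyD z : z \in [:: x; y] -> D z by move/xyM => [].
  have [[[_ GA _] _ _] _] := gen_star xyD.
  by apply: (homog_max_intro xyM); apply: GA; apply: gen_mem; rewrite // !inE eqxx ?orbT.
- move=> d x Dd Mx; have xM z : z \in [:: x] -> homog_max z by rewrite inE => /eqP ->.
  have xD z : z \in [:: x] -> D z by move/xM => [].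
  have [[[_ _ GM] _ _] _] := gen_star xD.
  by apply: (homog_max_intro xM); apply: GM => //; apply: gen_mem; rewrite // mem_head.
Qed.

Lemma homog_sub_max : subk I homog_max.
Proof. by move=> x Ix; apply: (@homog_max_intro [::]); [|apply: sub_gen]. Qed.

Lemma homog_max_universal N : star_ideal D star N -> integral D N -> N <> D -> subk I N ->
  subk N homog_max.
Proof.
move=> sN ND Nne IN x Nx; have Dx := ND x Nx; split=> // x1; apply: Nne.
apply: submodule_eq_ring => //; first by case: sN => [[]].
by apply: gen_sub x1 => // y; rewrite inE => /eqP ->.
Qed.

Lemma homog_max_max : max_star_ideal D star homog_max.
Proof.
have Mint : ideal_int D homog_max.
  split; [exact: homog_max_submodule | | by move=> x []].
  have [_ [y [Iy y0]] _] := homog_int HI; exists y; split=> //; exact: homog_sub_max.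
have Mf := ideal_int_frac HD Mint.
have [_ _ MD] := Mint.
split=> //.
(* Finite character puts [z] in the closure of the span of a finite list from [homog_max], hence in
   [gen t]. *)
- apply: star_idealI => // z /(Hfc Mf) [t [t0 tM tz]].
  have tM' x : x \in t -> homog_max x by move=> xt; apply: tM; apply: span_mem.
  have tD x : x \in t -> D x by move/tM' => [].
  apply: (homog_max_intro tM'); apply: star_least tz; first exact: span_frac.
    exact: gen_star.
  apply: span_sub; first by case: (gen_star tD) => [[]].
  by move=> x xt; apply: gen_mem; rewrite // mem_cat xt.
- move=> ME; have [_ []] : homog_max 1 by rewrite ME; apply: ring1.
  by apply: gen_mem; rewrite ?mem_head // => x; rewrite inE => /eqP ->; apply: ring1.
- move=> N sN ND Nne MN; apply: kset_ext => //; apply: homog_max_universal => //.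
  by move=> x /homog_sub_max /MN.
Qed.

End HomogMax.

Lemma homog_has_max I : star_homog D star I ->
  exists M, [/\ max_star_ideal D star M, subk I M &
    forall N, star_ideal D star N -> integral D N -> N <> D -> subk I N -> subk N M].
Proof.
move=> HI; have [_ _ [g [g0 Eg]] _ _] := HI; exists (homog_max g); split.
- exact: homog_max_max HI Eg g0.
- exact: homog_sub_max HI Eg g0.
- by move=> N; apply: homog_max_universal HI Eg g0 N.
Qed.

(** The factors are stripped one by one. For a factor [I] with maximal star-ideal [M], pick [c] in
    [B] off [M]; then [I + cD] has closure [D]. Any [y] in the product of the remaining factors maps
    [I + cD] into [B], so [y] itself is in [B]. *)
Lemma star_ideal_avoiding_max B l : star_ideal D star B -> integral D B ->
    (forall M, max_star_ideal D star M -> exists2 b, B b & ~ M b) ->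
    (forall I, List.In I l -> star_homog D star I) -> subk (iprod D l) B ->
  B 1.
Proof.
move=> sB BD Bmax; have [[Bs _ _] _] := sB.
elim: l => [|I l IHl] lH lB; first by apply: lB; apply: ring1.
apply: IHl => [J Jl|y ly]; first by apply: lH; right.
have HI := lH I (or_introl erefl); have [M [HM IM Muniv]] := homog_has_max HI.
have [c Bc nMc] := Bmax M HM; have Dc := BD c Bc.
have [Is _ _] := homog_int HI.
have Nint := iadd_principal_int (homog_int HI) Dc; have Nf := ideal_int_frac HD Nint.
have Cs : is_submodule D (principal D c) := scale_submodule _ (ring_submodule HD).
have N1 : star (iadd I (principal D c)) 1.
  apply/(star_eq_ring Nint); apply: NNPP => Nne; apply: nMc.
  have [_ _ ND] := star_int Nint.
  apply: (Muniv _ (star_ideal_star Nf)) => //.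
    by move=> x Ix; apply: (sub_star Nf); apply: (iaddl Cs).
  by apply: (sub_star Nf); apply: iadd_principal_mem.
have Dy : D y.
  have [_ _ lD] : ideal_int D (iprod D l); last exact: lD.
  by apply: iprod_ideal_int => // J Jl; apply: homog_int; apply: lH; right.
rewrite -[y]mulr1; apply: (star_transport Nf sB) N1.
have [_ BA BM] := Bs.
move=> _ [i [_ [Ii [d [Dd ->]] ->]]]; rewrite mulrDr; apply: BA.
  by apply: lB; rewrite mulrC; apply: imul_mem.
by have -> : y * (c * d) = y * d * c by [ring]; apply: BM => //; apply: ringM.
Qed.

(** * Local determination of star-ideals in a star-SH domain *)

Section SH.
Hypothesis HSH : star_SH D star.

(* A star-ideal of a star-SH domain is determined by its localizations at the maximal star-ideals. *)
Lemma star_ideal_local A x : star_ideal D star A -> integral D A -> D x ->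
    (forall M, max_star_ideal D star M -> exists2 d, off D M d & A (d * x)) ->
  A x.
Proof.
move=> sA AD Dx Aloc; have [[As [a [Aa a0]] _] _] := sA; have [_ _ AM] := As.
(* [B] is the conductor of [x] into [A]. It is a star-ideal contained in no maximal star-ideal, and
   it contains [aD], a product of homogeneous ideals up to closure unless [a] is a unit; hence it
   contains 1. *)
pose B d := D d /\ A (d * x).
have BD : integral D B by move=> d [].
have Bint : ideal_int D B.
  split=> //; last first.
    by exists a; split=> //; split; [apply: AD | rewrite mulrC; apply: AM].
  have [T0 TA TM] := transport_submodule x As.
  split.
  - by split; [apply: ring0 | rewrite mulrC].
  - move=> d e [Dd Ad] [De Ae]; split; first exact: ringD.
    by rewrite mulrC; apply: TA; rewrite mulrC.
  - move=> d e Dd [De Ae]; split; first exact: ringM.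
    by rewrite -mulrA; apply: AM.
have Bf := ideal_int_frac HD Bint.
have sB : star_ideal D star B.
  apply: star_idealI => // d Bd; split.
    by have [_ _] := star_int Bint; apply.
  rewrite mulrC; apply: (star_transport Bf sA) Bd.
  by move=> e [_]; rewrite mulrC.
have [[z [Dz az]]|nu] := classic (is_unit_in D a).
  by rewrite -[x]mulr1 -az (mulrC a) mulrA; apply: AM => //; apply: ringM.
have Ba : B a by split; [apply: AD | rewrite mulrC; apply: AM].
have [l [lH El]] := HSH (AD a Aa) a0 nu.
have lint : ideal_int D (iprod D l).
  by apply: iprod_ideal_int => // I /lH; apply: homog_int.
suff B1 : B 1 by case: B1; rewrite mul1r.
apply: (star_ideal_avoiding_max sB BD _ lH).
- by move=> M /Aloc [d [Dd nd] Ad]; exists d.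
- move=> y ly; have : principal D a y by rewrite El; apply: sub_star ly; apply: ideal_int_frac.
  move=> [d [Dd ->]]; rewrite mulrC; case: Bint => [[_ _ BM] _ _]; exact: BM.
Qed.

(** * Symbolic powers of a maximal star-ideal *)

Section Symbolic.
Variables (M : kset K) (p : K).
Hypotheses (HM : max_star_ideal D star M) (Hp : uniformizer D M p).

(* The symbolic power [p ^+ n D_M :&: D]. *)
Definition symb_pow n (x : K) := D x /\ exists2 s, off D M s & principal D (p ^+ n) (s * x).

Let HMp : prime_ideal D M := max_prime HM.

Let pow_frac n : is_frac_ideal D (principal D (p ^+ n)).
Proof. by apply: scale_frac; rewrite ?expf_neq0 ?(unif_neq0 Hp) //; apply: ring_frac. Qed.

Let pow_star n : star_ideal D star (principal D (p ^+ n)).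
Proof. by apply: star_ideal_principal; rewrite ?expf_neq0 ?(unif_neq0 Hp). Qed.

Let unif_pow_ring n : D (p ^+ n).
Proof. by apply: ringX => //; exact: (unif_ring HMp Hp). Qed.

Lemma symb_pow_int n : ideal_int D (symb_pow n).
Proof.
split; last by move=> x [].
  split.
  - split; first exact: ring0.
    exists 1; first exact: off1.
    by exists 0; rewrite !mulr0; split=> //; apply: ring0.
  - move=> x y [Dx [s os [d [Dd Ed]]]] [Dy [t ot [e [De Ee]]]].
    split; first exact: ringD.
    exists (s * t); first exact: offM.
    exists (t * d + s * e); split.
      by case: os ot => Ds _ [Dt _]; apply: ringD => //; apply: ringM.
    by transitivity (t * (s * x) + s * (t * y)); [ring | rewrite Ed Ee; ring].
  - move=> d x Dd [Dx [s os [e [De Ee]]]]; split; first exact: ringM.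
    by exists s => //; exists (d * e); split; [apply: ringM | rewrite mulrCA Ee; ring].
exists (p ^+ n); rewrite expf_neq0 ?(unif_neq0 Hp) //; split=> //; split=> //.
exists 1; first exact: off1.
by exists 1; rewrite mul1r mulr1; split=> //; apply: ring1.
Qed.

(** By finite character, [x] depends on a finite list [t] from the symbolic power. One multiplier
    [s] off [M] sends [t] into the principal star-ideal of [p ^+ n], hence also sends [x] there. *)
Lemma symb_pow_star n : star_ideal D star (symb_pow n).
Proof.
have Qint := symb_pow_int n; have Qf := ideal_int_frac HD Qint.
have [Qs _ _] := Qint.
apply: star_idealI => // x Qx; split; first by have [_ _] := star_int Qint; apply.
have [t [t0 tQ tx]] := (Hfc Qf x).1 Qx.
have [[ps _ _] _] := pow_star n.
have [y yt|s os sI] := off_common_multiplier HD HMp (t := t) ps.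
  by have [] := tQ y (span_mem HD yt).
exists s => //; apply: (star_transport _ (pow_star n)) tx.
  split=> //; first exact: span_submodule.
  exact: common_denominator.
by apply: span_sub sI; apply: transport_submodule.
Qed.

Lemma ipow_symb n : subk (ipow D M n) (symb_pow n).
Proof.
elim: n => [|n IHn].
  move=> x Dx; split=> //; exists 1; first exact: off1.
  by exists x; rewrite expr0 mul1r.
have [Qs _ _] := symb_pow_int n.+1.
apply: (imul_sub Qs) => x y Mx /IHn [Dy [t ot [d [Dd Ed]]]].
have Dx := prime_integral HMp Mx.
have [->|x0] := eqVneq x 0; first by rewrite mul0r; case: Qs.
have [k [s [e [os [De _] E]]]] := unif_prime_decomp HMp Hp Mx x0.
split; first exact: ringM.
exists (s * t); first exact: offM.
exists (p ^+ k * e * d); split; first by apply: ringM => //; apply: ringM.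
by rewrite mulrACA E Ed !exprS; ring.
Qed.

(** The inclusion is checked locally: at [M], the element [a] of value exactly [n] divides any
    element of the symbolic power up to a factor off [M]; at any other maximal star-ideal, [A] has
    an element outside it. *)
Lemma star_ideal_symb n A a s e : star_ideal D star A -> subk A (symb_pow n) ->
    A a -> off D M s -> off D M e -> s * a = p ^+ n * e ->
    (forall N, max_star_ideal D star N -> N <> M -> exists2 c, A c & ~ N c) ->
  A = symb_pow n.
Proof.
move=> sA AQ Aa [Ds _] oe E Aoff; apply: kset_ext => // x [Dx [t ot [d [Dd Ed]]]].
have AD : integral D A by move=> y /AQ [].
have [_ _ AM] : is_submodule D A by case: sA => [[]].
apply: star_ideal_local => // N HN; have [->|NM] := classic (N = M).
  exists (e * t); first exact: offM.
  have -> : e * t * x = d * s * a; last by apply: AM => //; apply: ringM.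
  by rewrite -!mulrA Ed E; ring.
have [c Ac nc] := Aoff N HN NM.
by exists c; [split=> //; apply: AD | rewrite mulrC; apply: AM].
Qed.

Lemma star_ipow_symb n : star (ipow D M n) = symb_pow n.
Proof.
have Mint := max_int HM; have Mn := ipow_ideal_int HD n Mint.
have Mf := ideal_int_frac HD Mn.
have pM : M p by case: Hp.
apply: (@star_ideal_symb _ _ (p ^+ n) 1 1).
- exact: star_ideal_star.
- by apply: star_least (symb_pow_star n) _ => //; apply: ipow_symb.
- by apply: sub_star => //; apply: ipow_mem.
- exact: off1.
- exact: off1.
- by rewrite mulrC.
- move=> N HN NM; apply: NNPP => nex; apply: NM.
  apply: (max_sub_eq HM HN); apply: (@prime_over_ipow _ _ n (max_prime HN) Mint) => x Mx.
  by apply: NNPP => nNx; apply: nex; exists x => //; apply: sub_star.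
Qed.

(** With [n] the least value at [M] of a nonzero element of [I], both sides are the symbolic power
    of exponent [n]. *)
Lemma homog_star_pow I : star_homog D star I -> subk I M ->
    (forall N, max_star_ideal D star N -> subk I N -> N = M) ->
  exists2 n, (0 < n)%N & I = star (ipow D M n).
Proof.
move=> HI IM Iuniq; have [Is [y [Iy y0]] ID] := homog_int HI.
have [_ _ Hdec] := Hp.
pose val n := exists a s e, [/\ I a, off D M s, off D M e & s * a = p ^+ n * e].
have [n [[a [s [e [Ia os oe E]]]] nmin]] : exists n, val n /\ forall m, val m -> (n <= m)%N.
  apply: ex_least; have [n [s [e [os oe E]]]] := Hdec y (ID y Iy) y0.
  by exists n, y, s, e.
exists n.
  (* Value 0 is impossible: [e = s * a] would lie in [M] because [I] does. *)
  case: n {nmin} E => // E; case: oe => _ []; rewrite -[e]mul1r -(expr0 p) -E.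
  by apply: prime_mulr HMp _ _ _ _; [case: os | apply: IM].
have [sI _ _ _ _] := HI.
rewrite star_ipow_symb; apply: star_ideal_symb Ia os oe E _ => //.
  move=> x Ix; have [->|x0] := eqVneq x 0; first by case: (symb_pow_int n) => [[]].
  have [k [t [f [ot oof F]]]] := Hdec x (ID x Ix) x0.
  have /nmin le_nk : val k by exists x, t, f.
  split; first exact: ID.
  exists t => //; exists (p ^+ (k - n) * f); split; first by apply: ringM => //; case: oof.
  by rewrite mulrA -exprD subnKC.
move=> N HN NM; apply: NNPP => nex; apply: NM; apply: (Iuniq N HN) => x Ix.
by apply: NNPP => nNx; apply: nex; exists x.
Qed.

End Symbolic.
End SH.

(** The given homogeneous factorization already works: each factor lies in exactly one maximal
    star-ideal, at which the localization is a discrete valuation ring, so it is the closure of a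
    power of that ideal. *)
Theorem Krull_SH_type2 : star_Krull D star -> star_SH_type2 D star.
Proof.
move=> [[HSH _] Hdvr] x Dx x0 nu; have [l [lH El]] := HSH x Dx x0 nu.
exists l; split=> // I /lH HI; split=> //.
have [M [HM IM Muniv]] := homog_has_max HI.
have [p Hp] := dvr_uniformizer HD (max_prime HM) (Hdvr M HM).
have [N HN IN|n n0 EI] := homog_star_pow HSH HM Hp HI IM; last by exists M, n.
case: (HN) => sN ND Nne _; apply/esym/(max_sub_eq HN HM).
exact: Muniv.
Qed.

End StarOperation.

Theorem theoremP4 (K : fieldType) (D : kset K) (star : kset K -> kset K)
  (HD : is_subring D) (HK : frac_field D)
  (Hstar : is_star_op D star) (Hfc : finite_character D star) :
  star_SH_type2 D star <-> star_Krull D star.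
Proof.
split; first exact: SH_type2_Krull.
exact: Krull_SH_type2.
Qed.
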